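(* Let $\mathcal{C}$ be a clutter over a ground set of $n$ elements. Then $\mathcal{C}$ is MFMC if, and only if, $\tau(\mathcal{C},w)=\nu(\mathcal{C},w)$ for all $w\in \mathbb{Z}^n_{\geq 0}$ such that every element belongs to some minimum $w$-weight cover of $\mathcal{C}$, and $$\tau(\mathcal{C},w)\leq \max\left\{\lceil n/2\rceil,\ \lfloor n-\sqrt{4n+1}+1\rfloor\right\}.$$
   Context: A clutter $\mathcal{C}$ over a finite ground set $E$ of elements is a family of subsets of $E$, none of which is contained in another. A cover of $\mathcal{C}$ is a subset $B\subseteq E$ that intersects every member of $\mathcal{C}$. For $w\in \mathbb{Z}^E_{\ge 0}$, write $w(B)=\sum_{e\in B}w_e$. Let $\tau(\mathcal{C},w)$ be the minimum of $w(B)$ over all covers $B$ of $\mathcal{C}$; a minimum $w$-weight cover is a cover $B$ (not necessarily inclusion-wise minimal) with $w(B)=\tau(\mathcal{C},w)$. Let $\nu(\mathcal{C},w)$ be the maximum of $\sum_{C\in\mathcal{C}}y_C$ over all $y\in\mathbb{Z}^{\mathcal{C}}_{\ge 0}$ with $\sum_{C\in\mathcal{C}: e\in C}y_C\le w_e$ for all $e\in E$. Convention: for the trivial clutter $\mathcal{C}=\{\emptyset\}$, $\tau(\mathcal{C},w)=\nu(\mathcal{C},w)=+\infty$. The clutter $\mathcal{C}$ is MFMC (has the max-flow min-cut property) if $\tau(\mathcal{C},w)=\nu(\mathcal{C},w)$ for all $w\in \mathbb{Z}^E_{\geq 0}$. *)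

(* Defs.v *)
From mathcomp Require Import all_boot all_order all_algebra.
From mathcomp Require Import all_classical all_reals.
From mathcomp Require Import zify.

Set Implicit Arguments.
Unset Strict Implicit.
Unset Printing Implicit Defensive.

Import Order.TTheory GRing.Theory Num.Theory.

Local Open Scope classical_set_scope.
Local Open Scope ring_scope.

Section Clutters.
Variable E : finType.
Implicit Types (C : {set {set E}}) (A B : {set E}) (w : E -> nat).

Definition clutter C : Prop :=
  {in C &, forall A B, A \subset B -> A = B}.

Definition is_cover C B : bool := [forall A in C, B :&: A != finset.set0].

Definition weight w B : nat := (\sum_(e in B) w e)%N.

(* Extended-integer valued: the only clutter without a cover is {set0}, and
   for it the empty minimum is +oo (tau_trivial, tau_attained). *)
Definition tau C w : \bar int :=
  \big[Order.min/+oo%E]_(B : {set E} | is_cover C B) (weight w B)%:Z%:E.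

Definition min_cover C w B : Prop :=
  is_cover C B /\ (weight w B)%:Z%:E = tau C w.

(* Only the values of a packing y on members of C are ever used. *)
Definition packing C w (y : {set E} -> nat) : Prop :=
  forall e, (\sum_(A in C | e \in A) y A <= w e)%N.

(* The supremum in the extended integers is +oo on an unbounded set, which
   happens only for C = {set0} (nu_trivial); otherwise it is attained
   (nu_attained). *)
Definition nu C w : \bar int :=
  supremum -oo%E [set (\sum_(A in C) y A)%N%:Z%:E | y in packing C w].

Definition mfmc C : Prop := forall w, tau C w = nu C w.

End Clutters.

Lemma supremum_max (S : set (\bar int)) m :
  S m -> ubound S m -> supremum -oo%E S = m.
Proof.
move=> Sm um; rewrite /supremum ifF; last first.
  by apply/negP => /eqP S0; move: Sm; rewrite S0.
have hm : supremums S m by split => // u; apply.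
by case: xgetP => [x _ hx|/(_ m)//]; exact: (is_subset1_supremums hx hm).
Qed.

Lemma tau_trivial (E : finType) (w : E -> nat) :
  tau [set finset.set0]%SET w = +oo%E.
Proof.
rewrite /tau big_pred0 // => B; apply/negP => /forallP /(_ finset.set0).
by rewrite inE eqxx finset.setI0 eqxx.
Qed.

Lemma nu_trivial (E : finType) (w : E -> nat) :
  nu [set finset.set0]%SET w = +oo%E.
Proof.
rewrite /nu /supremum; set S := (X in X == _).
have hS (k : nat) : S k%:Z%:E.
  exists (fun=> k); last by rewrite big_set1.
  by move=> e /=; rewrite big1 // => A /andP[]; rewrite inE => /eqP->; rewrite inE.
have ub x : ubound S x -> x = +oo%E.
  case: x => [z| |] // /[dup].
    by move=> /(_ _ (hS (absz z).+1)); rewrite lee_fin; lia.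
  by move=> /(_ _ (hS 0%N)).
have hm : supremums S +oo%E by split => [x _|u /ub -> //]; rewrite leey.
case: ifP => [/eqP S0|_]; first by have := hS 0%N; rewrite S0.
by case: xgetP => [x _ hx|/(_ +oo%E)//]; exact: (is_subset1_supremums hx hm).
Qed.

Lemma nu_attained (E : finType) (C : {set {set E}}) (w : E -> nat) :
  finset.set0 \notin C ->
  exists2 y, packing C w y & nu C w = (\sum_(A in C) y A)%N%:Z%:E.
Proof.
move=> C0.
have bnd y : packing C w y -> (\sum_(A in C) y A <= \sum_e w e)%N.
  move=> py; apply: (@leq_trans (\sum_e \sum_(A in C | e \in A) y A)%N);
    last exact: leq_sum.
  rewrite (exchange_big_dep (mem C)) /=; last by move=> ? ? _ /andP[].
  apply: leq_sum => A AC.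
  have /set0Pn[e eA] : A != finset.set0 by apply: contraNneq C0 => <-.
  by rewrite (bigD1 e) ?AC //= leq_addr.
pose P k := `[< exists2 y, packing C w y & (\sum_(A in C) y A)%N = k >].
have P0 : exists k, P k.
  by exists 0%N; apply/asboolP; exists (fun=> 0%N) => [e|]; rewrite big1.
have Pb k : P k -> (k <= \sum_e w e)%N by move=> /asboolP[y py <-]; exact: bnd.
case: (ex_maxnP P0 Pb) => m /asboolP[y py <-] mx.
exists y => //; apply: supremum_max; first by exists y.
by move=> _ [z pz <-]; rewrite lee_fin lez_nat; apply: mx; apply/asboolP; exists z.
Qed.

Lemma tau_attained (E : finType) (C : {set {set E}}) (w : E -> nat) :
  finset.set0 \notin C ->
  (exists B, min_cover C w B) /\
  forall B, is_cover C B -> (tau C w <= (weight w B)%:Z%:E)%E.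
Proof.
move=> C0; split; last by move=> B hB; exact: bigmin_le_cond.
have hT : is_cover C [set: E]%SET.
  by apply/forall_inP=> A AC; rewrite finset.setTI; apply: contraNneq C0 => <-.
rewrite /min_cover/tau.
have [B hB ->] := @eq_bigmin _ _ _ +oo%E [set: E]%SET (is_cover C)
  (fun B => (weight w B)%:Z%:E) hT (fun B _ => leey _).
by exists B.
Qed.

(* Main.v *)
Require Import Defs.
From mathcomp Require Import all_boot all_order all_algebra.
From mathcomp Require Import all_classical all_reals.
From mathcomp Require Import zify ring lra.

Set Implicit Arguments.
Unset Strict Implicit.
Unset Printing Implicit Defensive.

Import Order.TTheory GRing.Theory Num.Theory.

Local Open Scope ring_scope.

(** Write P(k) for: every weight function all of whose covers weigh at least
k has an integer packing of value at least k.  Away from the clutter whose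
only member is empty, MFMC says that P(k) holds for all k
([tau_eq_nuP]).  Lowering weights as long as all covers still weigh at least
k ends at a weight function in which every element lies in a cover of weight
exactly k ([tight_reduction]); so the hypothesis of the theorem gives P(j) for
all j up to the bound, and P(k) has to be derived for the larger k, by
induction on k.

Fractional packings come first.  Suppose that P(j) holds for j at most half
of n, rounded up.  Then every vertex x of the covering polyhedron is integral:
expand a unit vector in a basis of constraints tight at x and keep only the
fractional parts z of the coefficients.  This gives a nonnegative integer
weight function whose fractional optimum is the sum val of the z over the
members in the basis.  If x were fractional somewhere, val would not be an
integer, so the minimum cover would weigh at least the ceiling of val and no
integer packing could reach it.  Replacing z by 1 - z if necessary makes val at
most n/2, which contradicts P ([value_int], [vertex_int]).  By LP duality (Farkas), a
fractional packing of value k exists as soon as all covers weigh at least k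
([fractional_packing]).

Now let w be a tight weight function that violates P(k), while P(j) holds for
j < k.  All fractional packings y of value k satisfy complementary slackness
with all covers of weight k: they use up w exactly, and the members in their
support meet each of those covers in one element.  Each coefficient is below 1,
for otherwise one could remove a member from w and use P(k - 1).  Take y of
smallest support, of size m; its members are linearly independent.  The
coefficients 1 - y_A pack the residual weight w', which counts how often the
support covers an element beyond w; its covers weigh at least s = m - k, and
w' is positive on the support of w, a set of n' elements.  If s >= k then
2 k <= m <= n.  Otherwise P(s) yields an integer packing of w' by s members.
Let d be the size of a minimal family of minimum covers that covers the n'
elements.  Those d covers are independent too, and comparing ranks gives
m + d <= n' + 1 ([card_indep]).  Each of the s members has at most d elements,
so n' <= s d ([residual_total]).  Hence k + (s + d) <= n' + 1 where
(s + d)^2 >= 4 s d >= 4 n', which is the second bound, except that one needs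
4 n' + 1 in place of 4 n'.

This can only fail if s = d, n' = s d, and w' is 1 on all n' elements, for
every y of smallest support.  Then some member A0 of the integer packing of w'
is outside the support of y, since independence would otherwise force
1 - y_A to be an integer ([residual_packing_new_member]).  By the rank bound A0
depends linearly on the support, so it can be pivoted in for some A1
([basic_swap]).  Both supports have the same residual, which forces
A0 = A1. *)

(** * Farkas' lemma *)

Section Dot.
Variables (F : realFieldType) (T : finType).
Implicit Types (u v : T -> F).

Definition dot u v : F := \sum_t u t * v t.

Lemma eq_dot u v u' v' : u =1 u' -> v =1 v' -> dot u v = dot u' v'.
Proof. by move=> eu ev; apply: eq_bigr => t _; rewrite eu ev. Qed.

Lemma dotC u v : dot u v = dot v u.
Proof. by apply: eq_bigr => t _; rewrite mulrC. Qed.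

Lemma dot_combl a u v (c : T -> F) :
  dot (fun t => u t + a * v t) c = dot u c + a * dot v c.
Proof.
by rewrite /dot mulr_sumr -big_split; apply: eq_bigr => t _ /=; ring.
Qed.

Lemma dot_combr a u v (c : T -> F) :
  dot c (fun t => u t + a * v t) = dot c u + a * dot c v.
Proof.
by rewrite /dot mulr_sumr -big_split; apply: eq_bigr => t _ /=; ring.
Qed.

Lemma dot_suml (I : finType) (z : I -> F) (a : I -> T -> F) (c : T -> F) :
  dot (fun t => \sum_i z i * a i t) c = \sum_i z i * dot (a i) c.
Proof.
rewrite /dot; under eq_bigr => t _ do rewrite mulr_suml.
rewrite exchange_big; apply: eq_bigr => i _ /=.
by rewrite mulr_sumr; apply: eq_bigr => t _; ring.
Qed.

Lemma dot_ge0 u v : (forall t, 0 <= u t) -> (forall t, 0 <= v t) -> 0 <= dot u v.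
Proof. by move=> u0 v0; apply: sumr_ge0 => t _; exact: mulr_ge0. Qed.

Lemma dot_indic u (B : {set T}) : dot u (fun t => (t \in B)%:R) = \sum_(t in B) u t.
Proof.
rewrite /dot [RHS]big_mkcond; apply: eq_bigr => t _.
by case: (t \in B); rewrite ?mulr1 ?mulr0.
Qed.

(** Induction on the number of generators.  If some c0 separates b from the
first m generators but not from the last one, then projecting everything along
the last generator onto the hyperplane orthogonal to c0 reduces to m
generators. *)
Lemma farkas_nat m (a : nat -> T -> F) (b : T -> F) :
  (exists2 u : nat -> F, (forall i, 0 <= u i)
     & forall t, b t = \sum_(i < m) u i * a i t)
  \/ (exists2 c : T -> F, (forall i, (i < m)%N -> 0 <= dot (a i) c) & dot b c < 0).
Proof.
elim: m a b => [|m IH] a b.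
  have [b0|nb] := pselect (forall t, b t = 0).
    by left; exists (fun=> 0) => // t; rewrite big_ord0.
  right; exists (fun t => - b t) => //.
  have [t /eqP bt] : exists t, b t <> 0 by exact/existsNP.
  rewrite /dot (bigD1 t) //=.
  have : \sum_(i | i != t) b i * - b i <= 0.
    by apply: sumr_le0 => i _; rewrite mulrN oppr_le0 -expr2 sqr_ge0.
  have : 0 < b t ^+ 2 by rewrite exprn_even_gt0.
  nra.
case: (IH a b) => [[u u0 ub]|[c0 c0a c0b]].
  left; exists (fun i => if (i < m)%N then u i else 0) => [i|t]; first by case: ifP.
  rewrite big_ord_recr /= ltnn mul0r addr0 ub.
  by apply: eq_bigr => i _; rewrite ltn_ord.
have [am|am] := lerP 0 (dot (a m) c0).
  right; exists c0 => // i; rewrite ltnS leq_eqVlt => /orP[/eqP->//|]; exact: c0a.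
set al := dot (a m) c0 in am.
pose a' i t := a i t + (- (dot (a i) c0 / al)) * a m t.
pose b' t := b t + (- (dot b c0 / al)) * a m t.
case: (IH a' b') => [[u u0 ub]|[c ca cb]].
  pose um := dot b c0 / al - \sum_(i < m) u i * (dot (a i) c0 / al).
  left; exists (fun i => if (i < m)%N then u i else um) => [i|t].
    case: ifP => // _; rewrite /um subr_ge0; apply: (@le_trans _ _ 0).
      apply: sumr_le0 => i0 _; apply: mulr_ge0_le0 => //.
      by rewrite ler_ndivrMr // mul0r c0a.
    by rewrite ltW // ltr_ndivlMr // mul0r.
  rewrite big_ord_recr /= ltnn.
  under eq_bigr => i _ do rewrite ltn_ord.
  have -> : b t = b' t + dot b c0 / al * a m t by rewrite /b'; ring.
  have -> : b' t = \sum_(i < m) u i * a i t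
                   - (\sum_(i < m) u i * (dot (a i) c0 / al)) * a m t.
    by rewrite ub mulr_suml -sumrB; apply: eq_bigr => i _ /=; rewrite /a'; ring.
  by rewrite /um; ring.
right.
pose r := dot (a m) c / al.
(* The projection is self-adjoint in the sense that projecting c along c0
   pairs with f as c does with the projection of f. *)
have E f : dot f (fun t => c t + (- r) * c0 t)
         = dot (fun t => f t + (- (dot f c0 / al)) * a m t) c.
  by rewrite dot_combr dot_combl /r; ring.
exists (fun t => c t + (- r) * c0 t); last by rewrite E.
move=> i; rewrite ltnS leq_eqVlt => /orP[/eqP->|im]; last by rewrite E; exact: ca.
by rewrite dot_combr /r mulNr divfK ?subrr // lt_eqF.
Qed.

Lemma farkas (I : finType) (a : I -> T -> F) (b : T -> F) :
  (exists2 u : I -> F, (forall i, 0 <= u i) & forall t, b t = \sum_i u i * a i t)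
  \/ (exists2 c : T -> F, (forall i, 0 <= dot (a i) c) & dot b c < 0).
Proof.
pose a' k := if insub k is Some o then a (enum_val (o : 'I_#|I|)) else fun=> 0.
have a'E (o : 'I_#|I|) : a' o = a (enum_val o) by rewrite /a' valK.
case: (farkas_nat #|I| a' b) => [[u u0 ub]|[c ca cb]].
  left; exists (fun i => u (enum_rank i)) => // t.
  rewrite ub (reindex (@enum_val I I)) /=; last first.
    by exists enum_rank => i _; [exact: enum_valK | exact: enum_rankK].
  by apply: eq_bigr => i _; rewrite a'E enum_valK.
right; exists c => // i.
by have := ca (enum_rank i) (ltn_ord _); rewrite a'E enum_rankK.
Qed.
End Dot.

(** * The numerical bound *)

(** The condition j <= max (ceil (n / 2)) (floor (n - sqrt (4 n + 1) + 1)) on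
naturals: q stands for any integer not below the square root. *)
Definition small_value n j := (2 * j <= n + 1)%N \/
  exists2 q, (4 * n + 1 <= q ^ 2)%N & (j + q <= n + 1)%N.

(** The three alternatives supply the 1 in 4 n' + 1 that the inequality of
arithmetic and geometric means lacks. *)
Lemma small_value_of_counts n n' k s d : (0 < n')%N -> (n' <= n)%N -> (0 < k)%N ->
  (k + s + d <= n' + 1)%N -> (n' <= s * d)%N ->
  [\/ (k + s + d < n' + 1)%N, (n' < s * d)%N | s != d] -> small_value n k.
Proof.
move=> n'0 n'n k0 ksd sd alt; right.
suff [q q1 q2] : exists2 q, (4 * n' + 1 <= q ^ 2)%N & (k + q <= n' + 1)%N.
  (* Raising n' and q by the same t adds 2 q t + t^2 to q^2, and 2 q >= 4. *)
  exists (q + (n - n'))%N; last by lia.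
  have q3 : (2 < q)%N.
    move: q1; clear -n'0; case: q => [|[|[|q]]] //; rewrite !expnS expn0; lia.
  have [t tE] : exists t, n = (n' + t)%N by exists (n - n')%N; lia.
  by rewrite tE (_ : n' + t - n' = t)%N; [rewrite !expnS !expn0 !muln1 in q1 *; nia|lia].
(* [s - d + (d - s)] is the distance of s and d, as one difference is 0. *)
have amgm : (4 * (s * d) + (s - d + (d - s)) ^ 2 = (s + d) ^ 2)%N.
  have [sd'|/ltnW sd'] := leqP s d.
    have [t tE] : exists t, d = (s + t)%N by exists (d - s)%N; lia.
    rewrite tE (_ : s - (s + t) + (s + t - s) = t)%N; last lia.
    by rewrite !expnS !expn0 !muln1; nia.
  have [t tE] : exists t, s = (d + t)%N by exists (s - d)%N; lia.
  rewrite tE (_ : d + t - d + (d - (d + t)) = t)%N; last lia.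
  by rewrite !expnS !expn0 !muln1; nia.
case: alt => [alt|alt|alt].
- exists (s + d + 1)%N; last by lia.
  by move: amgm; rewrite !expnS !expn0 !muln1; nia.
- by exists (s + d)%N; lia.
- exists (s + d)%N; last by lia.
  have : (0 < (s - d + (d - s)) ^ 2)%N by rewrite expn_gt0; lia.
  lia.
Qed.

Lemma small_value_le (R : realType) n j : small_value n j ->
  (j%:Z <= Order.max (Num.ceil (n%:R / 2 : R))
           (Num.floor (n%:R - Num.sqrt (4 * n%:R + 1) + 1 : R)))%R.
Proof.
rewrite le_max => -[h|[q q1 q2]]; apply/orP.
  left; case: j h => [|j] h; first by rewrite ceil_ge0 (lt_le_trans (ltrN10 _)) // divr_ge0.
  rewrite -[j.+1]addn1 PoszD lezD1 ceil_gt_int ltr_pdivlMr // -natrM ltr_nat; lia.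
right; rewrite floor_ge_int.
have sq : Num.sqrt (4 * n%:R + 1) <= q%:R :> R.
  rewrite -(ger0_norm (ler0n R q)) -sqrtr_sqr ler_sqrt ?sqr_ge0 //.
  by rewrite -natrX -natrM natr1 ler_nat; lia.
have : (j + q)%:R <= (n + 1)%:R :> R by rewrite ler_nat.
rewrite !natrD -pmulrn; lra.
Qed.

(** * Fractional packings and covers *)

Lemma sum_option (V : nmodType) (I : finType) (f : option I -> V) :
  \sum_i f i = f None + \sum_i f (Some i).
Proof.
rewrite (bigD1 None) //=; congr (_ + _).
by rewrite (reindex_omap Some id) //= => [|[]//]; apply: eq_bigl => i; rewrite eqxx.
Qed.

Section Clutter.
Variables (F : archiRealFieldType) (E : finType) (C : {set {set E}}).
Implicit Types (A B : {set E}) (w : E -> nat) (x d : E -> F) (y : {set E} -> F).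

Definition chi A : E -> F := fun e => (e \in A)%:R.
Definition wvec w : E -> F := fun e => (w e)%:R.
Definition load y : E -> F := fun e => \sum_(A in C) y A * chi A e.
Definition value y : F := \sum_(A in C) y A.
Definition fpacking w y := (forall A, 0 <= y A) /\ forall e, load y e <= wvec w e.

(** The covering polyhedron is cut out by one constraint for each member and
one nonnegativity constraint for each element; sets outside C give no
constraint. *)
Definition constr : Type := ({set E} + E)%type.
Definition lhs (c : constr) : E -> F :=
  match c with inl A => chi A | inr f => chi [set f] end.
Definition rhs (c : constr) : F := if c is inl _ then 1 else 0.
Definition valid (c : constr) := if c is inl A then A \in C else true.
Definition feasible x := forall c, valid c -> rhs c <= dot (lhs c) x.

(** [covers_ge w k] and [packs w k] say tau >= k and nu >= k, which avoids the
extended integers. *)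
Definition covers_ge w k := forall B, is_cover C B -> (k <= weight w B)%N.
Definition packs w k :=
  exists2 y : {set E} -> nat, packing C w y & (k <= \sum_(A in C) y A)%N.

Lemma chiX A e : chi A e = (e \in A)%:R. Proof. by []. Qed.

Lemma dot_chi1 f x : dot (chi [set f]) x = x f.
Proof.
rewrite /dot (bigD1 f) //= chiX inE eqxx mul1r big1 ?addr0 // => e ef.
by rewrite chiX inE (negbTE ef) mul0r.
Qed.

Lemma dot_chiI A B : dot (chi A) (chi B) = #|A :&: B|%:R.
Proof.
rewrite (dot_indic (chi A)) -sum1_card natr_sum big_mkcond [RHS]big_mkcond.
by apply: eq_bigr => e _; rewrite chiX inE; case: (e \in A); case: (e \in B).
Qed.

Lemma feasible_ge0 x : feasible x -> forall e, 0 <= x e.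
Proof. by move=> fx e; have := fx (inr e) isT; rewrite /= dot_chi1. Qed.

Lemma feasible_member x A : feasible x -> A \in C -> 1 <= dot (chi A) x.
Proof. by move=> fx inCA; exact: (fx (inl A)). Qed.

Lemma feasibleP x : (forall e, 0 <= x e) -> (forall A, A \in C -> 1 <= dot (chi A) x) ->
  feasible x.
Proof. by move=> x0 xA [A /xA//|e _]; rewrite /= dot_chi1. Qed.

Lemma cover_card B A : is_cover C B -> A \in C -> (0 < #|A :&: B|)%N.
Proof. by move=> /forall_inP h /h; rewrite finset.setIC card_gt0. Qed.

Lemma feasible_cover B : is_cover C B -> feasible (chi B).
Proof.
move=> hB; apply: feasibleP => [e|A inCA]; first exact: ler0n.
by rewrite dot_chiI ler1n; exact: cover_card.
Qed.

Lemma weightE w B : (weight w B)%:R = dot (wvec w) (chi B).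
Proof. by rewrite /weight natr_sum dot_indic. Qed.

Lemma dot_load y x : dot (load y) x = \sum_(A in C) y A * dot (chi A) x.
Proof.
rewrite [RHS]big_mkcond /=.
rewrite -(eq_bigr _ (fun A _ => _ : (if A \in C then y A else 0) * dot (chi A) x = _)).
  rewrite -dot_suml; apply: eq_dot => // e.
  by rewrite /load big_mkcond; apply: eq_bigr => A _; case: ifP; rewrite ?mul0r.
by move=> A; case: ifP; rewrite ?mul0r.
Qed.

Lemma ler_dotl u v x : (forall e, 0 <= x e) -> (forall e, u e <= v e) ->
  dot u x <= dot v x.
Proof. by move=> x0 uv; apply: ler_sum => e _; exact: ler_wpM2r. Qed.

Lemma weak_duality w y x : fpacking w y -> feasible x -> value y <= dot (wvec w) x.
Proof.
move=> [y0 yw] fx; apply: (le_trans _ (ler_dotl (feasible_ge0 fx) yw)).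
rewrite dot_load; apply: ler_sum => A inCA.
by apply: ler_peMr => //; exact: feasible_member.
Qed.

Lemma fpacking_nat w (y : {set E} -> nat) : packing C w y ->
  fpacking w (fun A => (y A)%:R).
Proof.
move=> py; split=> [A|e]; first exact: ler0n.
rewrite /load /wvec; apply: le_trans (_ : (\sum_(A in C | e \in A) y A)%:R <= _).
  rewrite natr_sum big_mkcondr /=; apply: ler_sum => A _.
  by rewrite chiX; case: (e \in A); rewrite ?mulr1 ?mulr0.
by rewrite ler_nat.
Qed.

Lemma value_nat (y : {set E} -> nat) :
  value (fun A => (y A)%:R) = (\sum_(A in C) y A)%:R.
Proof. by rewrite /value natr_sum. Qed.

(** LP duality, as Farkas' lemma for the cone in one more dimension that is
generated by the members, each of value 1, by the unit vectors, of value 0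
(unused capacity), and by a generator of value -1. *)
Lemma frac_duality w (k : F) :
  (exists2 y, fpacking w y & k <= value y)
  \/ (exists2 x, feasible x & dot (wvec w) x < k).
Proof.
(* The coordinate [None] records the value of the packing; the generator
   [None] allows that value to exceed k. *)
pose gen (i : option constr) (t : option E) : F :=
  match i, t with
  | None, t => if t is None then -1 else 0
  | Some c, None => if valid c then rhs c else 0
  | Some c, Some e => if valid c then lhs c e else 0
  end.
pose b t := if t is Some e then wvec w e else k.
have dotE u v : @dot F (option E) u v = u None * v None + dot (u \o Some) (v \o Some).
  by rewrite /dot sum_option.
case: (farkas gen b) => [[u u0 ub]|[c ca cb]].
  left; exists (fun A => u (Some (inl A))).
    split=> // e; have /= -> := ub (Some e).
    rewrite sum_option /= mulr0 add0r big_sumType /= ler_wpDr //.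
      by apply: sumr_ge0 => f _; apply: mulr_ge0 => //; exact: ler0n.
    rewrite /load big_mkcond /=; apply: ler_sum => A _.
    by case: ifP; rewrite ?mulr0.
  have /= -> := ub None.
  rewrite sum_option big_sumType /= [X in _ + (_ + X)]big1 => [|f _]; last by rewrite mulr0.
  rewrite addr0 /value [leRHS]big_mkcond /= mulrN1 addrC lerBlDr.
  rewrite ler_wpDr //; apply: ler_sum => A _.
  by case: ifP; rewrite ?mulr0 ?mulr1.
right.
have c_None : c None <= 0.
  have := ca None; rewrite dotE /= mulN1r [dot _ _]big1 => [|e _]; last by rewrite /= mul0r.
  lra.
have c_e e : 0 <= c (Some e).
  by have := ca (Some (inr e)); rewrite dotE /= mul0r add0r (dot_chi1 e).
have c_A A : A \in C -> - c None <= dot (chi A) (c \o Some).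
  move=> inCA; have := ca (Some (inl A)); rewrite dotE /= inCA mul1r.
  rewrite (_ : dot _ _ = dot (chi A) (c \o Some)); last first.
    by apply: eq_dot => e //=; rewrite inCA.
  lra.
have {}cb : dot (wvec w) (c \o Some) < k * - c None.
  by move: cb; rewrite dotE /=; rewrite (_ : dot _ _ = dot (wvec w) (c \o Some)) //; lra.
(* The separating vector must be scaled by [- c None], which is nonzero
   because w and the other coordinates are nonnegative. *)
have w0 : 0 <= dot (wvec w) (c \o Some) by apply: dot_ge0 => e; [exact: ler0n|exact: c_e].
have c_None' : 0 < - c None.
  rewrite oppr_gt0 lt_neqAle c_None andbT; apply: contraTneq cb => ->.
  by rewrite oppr0 mulr0 -leNgt.
have dotZ u : dot u (fun e => c (Some e) / - c None) = dot u (c \o Some) / - c None.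
  by rewrite /dot mulr_suml; apply: eq_bigr => e _ /=; rewrite mulrA.
exists (fun e => c (Some e) / - c None); last by rewrite dotZ ltr_pdivrMr.
apply: feasibleP => [e|A inCA]; first by rewrite divr_ge0 // ltW.
by rewrite dotZ ler_pdivlMr // mul1r c_A.
Qed.

Definition tight x := [set c : constr | valid c && (dot (lhs c) x == rhs c)].

(** Stated dually: the constraints tight at x have full rank. *)
Definition vertex x := forall d, (forall c, c \in tight x -> dot (lhs c) d = 0) ->
  forall e, d e = 0.

(** Move along a line that keeps the tight constraints tight and does not
increase the cost, until one more constraint becomes tight.  The line can be
oriented so that it leaves the polyhedron: a direction without negative entry
that does not increase the cost has cost 0, so its opposite serves as well. *)
Lemma vertex_below w (k : F) x : feasible x -> dot (wvec w) x < k ->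
  exists x', [/\ feasible x', dot (wvec w) x' < k & vertex x'].
Proof.
move: {2}(#|~: tight x|).+1 (ltnSn #|~: tight x|) => m.
elim: m x => // m IH x; rewrite ltnS => xm fx xk.
have [vx|nv] := pselect (vertex x); first by exists x.
have w0 e : 0 <= wvec w e by exact: ler0n.
have [d [dt dw [f df]]] : exists d, [/\ forall c, c \in tight x -> dot (lhs c) d = 0,
    dot (wvec w) d <= 0 & exists f, d f < 0].
  have [d dt [g dg]] : exists2 d, (forall c, c \in tight x -> dot (lhs c) d = 0)
     & exists g, d g != 0.
    apply: contra_notP nv => h d dt e; apply/eqP; apply: contra_notT h => de.
    by exists d => //; exists e.
  have opp u : dot u (fun e => - d e) = - dot u d.
    by rewrite /dot -sumrN; apply: eq_bigr => e _; rewrite mulrN.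
  have [wd|wd] := lerP (dot (wvec w) d) 0; last first.
    exists (fun e => - d e); split=> [c /dt|| ].
    - by rewrite opp => ->; rewrite oppr0.
    - by rewrite opp oppr_le0 ltW.
    - have : ~ forall e, d e <= 0.
        move=> h; move: wd; rewrite ltNge => /negP; apply.
        by apply: sumr_le0 => e _; rewrite mulr_ge0_le0.
      move=> /existsNP[e /negP]; rewrite -ltNge => de; exists e.
      by rewrite oppr_lt0.
  have [[e de]|h] := pselect (exists e, d e < 0).
    by exists d; split=> //; exists e.
  have d0 e : 0 <= d e by rewrite leNgt; apply/negP => de; apply: h; exists e.
  have wd0 : dot (wvec w) d = 0.
    by apply/eqP; rewrite eq_le wd dot_ge0.
  exists (fun e => - d e); split=> [c /dt|| ].
  - by rewrite opp => ->; rewrite oppr0.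
  - by rewrite opp wd0 oppr0.
  - by exists g; rewrite oppr_lt0 lt_neqAle eq_sym dg d0.
pose V := [pred c | valid c && (dot (lhs c) d < 0)].
(* Step length at which the constraint c becomes tight. *)
pose ratio c := (dot (lhs c) x - rhs c) / - dot (lhs c) d.
have Vf : V (inr f) by rewrite /V /= dot_chi1.
case: (arg_minP ratio Vf) => c /andP[cv cd] cmin.
set t := ratio c in cmin.
have t0 : 0 <= t.
  by rewrite /t /ratio divr_ge0 ?subr_ge0 ?fx // oppr_ge0 ltW.
have x'E u : dot u (fun e => x e + t * d e) = dot u x + t * dot u d by exact: dot_combr.
apply: (IH (fun e => x e + t * d e)).
- apply: (leq_trans _ xm); apply: proper_card.
  rewrite properC; apply/properP; split.
    apply/fintype.subsetP => c' c't; move: (c't); rewrite !inE x'E (dt _ c't) mulr0 addr0.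
    by [].
  exists c; last first.
    rewrite inE negb_and cv /=; apply: contraTneq cd => ct.
    by rewrite dt ?ltxx // inE cv ct eqxx.
  rewrite inE cv /= x'E /t /ratio.
  by apply/eqP; field; rewrite lt_eqF.
- move=> c' c'v; rewrite x'E.
  have [c'd|c'd] := lerP 0 (dot (lhs c') d).
    by rewrite (le_trans (fx _ c'v)) // lerDl mulr_ge0.
  have : t <= ratio c' by apply: cmin; rewrite /V /= c'v.
  rewrite /ratio ler_pdivlMr ?oppr_gt0 //; lra.
- by rewrite x'E; apply: le_lt_trans xk; rewrite gerDl mulr_ge0_le0.
Qed.

(** * Integrality of the covering polyhedron *)

Section Ideal.

Lemma tight_basis x : vertex x ->
  exists2 r : 'I_#|E| -> constr, forall i, r i \in tight x
    & forall v : E -> F, exists c : 'I_#|E| -> F,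
        forall e, v e = \sum_i c i * lhs (r i) e.
Proof.
move=> vx.
pose T : 'M[F]_(#|tight x|, #|E|) := \matrix_(i, j) lhs (enum_val i) (enum_val j).
have fullT : row_full T.
  rewrite /row_full -mxrank_tr -/(row_free T^T) -kermx_eq0.
  apply/rowV0P => v /sub_kermxP vT.
  have vd : forall e, v 0 (enum_rank e) = 0.
    apply: vx => c ct; have := congr1 (fun M : 'M_(_, _) => M 0 (enum_rank_in ct c)) vT.
    rewrite !mxE => <-; rewrite /dot (reindex (@enum_val E E)) /=; last first.
      by exists enum_rank => i _; [exact: enum_valK | exact: enum_rankK].
    by apply: eq_bigr => j _; rewrite !mxE enum_rankK_in // enum_valK mulrC.
  by apply/rowP => j; rewrite mxE -[j]enum_valK vd.
pose N := rowsub (fullrankfun fullT) T.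
exists (fun i => enum_val (fullrankfun fullT i)) => [i|v]; first exact: enum_valP.
pose V : 'rV[F]_#|E| := \row_j v (enum_val j).
exists (fun i => (V *m invmx N) 0 i) => e.
have := congr1 (fun M : 'M_(_, _) => M 0 (enum_rank e))
  (mulmxKV (fullrowsub_unit fullT) V).
rewrite /= [in RHS]mxE enum_rankK => <-; rewrite mxE.
by apply: eq_bigr => i _; rewrite !mxE enum_rankK.
Qed.

Lemma rhs_int c : rhs (c : constr) \is a Num.int.
Proof. by case: c => ?; [exact: rpred1|exact: rpred0]. Qed.

Lemma lhs_int (c : constr) e : lhs c e \is a Num.int.
Proof. by case: c => ?; exact: natr_int. Qed.

Section SmallValues.
Hypothesis small : forall j, (2 * j <= #|E| + 1)%N ->
  forall w, covers_ge w j -> packs w j.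
Variables (x : E -> F) (r : 'I_#|E| -> constr).
Hypotheses (fx : feasible x) (rx : forall i, r i \in tight x).
Implicit Types z : 'I_#|E| -> F.

Let rv i : valid (r i). Proof. by have := rx i; rewrite inE => /andP[]. Qed.
Let rt i : dot (lhs (r i)) x = rhs (r i).
Proof. by have := rx i; rewrite inE => /andP[_ /eqP]. Qed.

(** The combination of the tight constraints with coefficients z is an
integer weight function w whose fractional optimum is val, attained by x.  If
val is not an integer, then covers weigh at least its ceiling j, but no integer
packing has value j > val; and j <= ceil (n / 2) as val < j and val <= n / 2. *)
Lemma half_value_int z : (forall i, 0 <= z i) ->
  (forall e, \sum_i z i * lhs (r i) e \is a Num.int) ->
  2 * (\sum_i z i * rhs (r i)) <= #|E|%:R ->
  \sum_i z i * rhs (r i) \is a Num.int.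
Proof.
move=> z0 zint; set val := \sum_i _ => val2; apply: contraT => valN.
have lhs0 c e : 0 <= lhs c e by case: c => ?; exact: ler0n.
have /choice[w wE] : forall e, exists m : nat, \sum_i z i * lhs (r i) e = m%:R.
  move=> e; apply/natrP; rewrite natrEint zint sumr_ge0 // => i _.
  by rewrite mulr_ge0.
have wdot u : dot (wvec w) u = \sum_i z i * dot (lhs (r i)) u.
  by rewrite -dot_suml; apply: eq_dot => // e; rewrite /wvec -wE.
have val0 : 0 <= val.
  by apply: sumr_ge0 => i _; rewrite mulr_ge0 //; case: (r i).
have /natrP[f fE] : (Num.floor val)%:~R \is a @Num.nat F.
  by rewrite natrEint intr_int ler0z floor_ge0.
have fval : f%:R < val.
  by rewrite lt_neqAle -fE floor_le andbT; apply: contraNneq valN => <-; exact: intr_int.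
have valf : val < f.+1%:R by have := floorD1_gt val; rewrite intrD fE natr1.
have hw : covers_ge w f.+1.
  move=> B hB; rewrite -(ltr_nat F); apply: lt_le_trans fval _.
  rewrite weightE wdot; apply: ler_sum => i _; apply: ler_wpM2l => //.
  exact: feasible_cover (rv i).
have f2 : (2 * f.+1 <= #|E| + 1)%N.
  suff : (2 * f < #|E|)%N by lia.
  by rewrite -(ltr_nat F) natrM; lra.
have [y py ky] := small f2 hw.
have := weak_duality (fpacking_nat py) fx.
rewrite value_nat wdot => hy.
have : (f.+1)%:R <= val.
  rewrite /val -(eq_bigr _ (fun i _ => congr1 (fun t => z i * t) (rt i))).
  by apply: le_trans hy; rewrite ler_nat.
by rewrite leNgt valf.
Qed.

(** The values of z and of 1 - z add up to the number of members in the basis,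
hence to an integer that is at most n; one of the two is at most n / 2. *)
Lemma value_int z : (forall i, 0 <= z i <= 1) ->
  (forall e, \sum_i z i * lhs (r i) e \is a Num.int) ->
  \sum_i z i * rhs (r i) \is a Num.int.
Proof.
move=> z01 zint; set val := \sum_i _.
have [/half_value_int|] := lerP (2 * val) #|E|%:R.
  by apply=> // i; have /andP[] := z01 i.
move=> val2.
pose z' i := 1 - z i.
have val'E : \sum_i z' i * rhs (r i) = \sum_i rhs (r i) - val.
  by rewrite -sumrB; apply: eq_bigr => i _; rewrite mulrBl mul1r.
have rhsn : \sum_i rhs (r i) <= #|E|%:R.
  apply: (@le_trans _ _ (\sum_(i < #|E|) 1)); last by rewrite sumr_const card_ord.
  apply: ler_sum => i _.
  by case: (r i) => //= _; exact: ler01.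
have : \sum_i z' i * rhs (r i) \is a Num.int.
  apply: half_value_int => [i|e|].
  - by rewrite subr_ge0; have /andP[] := z01 i.
  - have -> : \sum_i z' i * lhs (r i) e = \sum_i lhs (r i) e - \sum_i z i * lhs (r i) e.
      by rewrite -sumrB; apply: eq_bigr => i _; rewrite mulrBl mul1r.
    by rewrite rpredB // rpred_sum // => i _; exact: lhs_int.
  - by rewrite val'E; lra.
rewrite val'E => h; rewrite -[val](subKr (\sum_i rhs (r i))) rpredB //.
by apply: rpred_sum => i _; exact: rhs_int.
Qed.

End SmallValues.

Hypothesis small : forall j, (2 * j <= #|E| + 1)%N ->
  forall w, covers_ge w j -> packs w j.

(** In the expansion of the unit vector of e in the tight basis, applying the
constraints to x turns the left side into x e and the right side into a sum
over the coefficients of the members.  The integer parts contribute an integer,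
the fractional parts fall under [value_int]. *)
Lemma vertex_int x : feasible x -> vertex x -> forall e, x e \is a Num.int.
Proof.
move=> fx vx e; have [r rx span] := tight_basis vx.
have rt i : dot (lhs (r i)) x = rhs (r i).
  by have := rx i; rewrite inE => /andP[_ /eqP].
have [c cE] := span (chi [set e]).
pose z i := c i - (Num.floor (c i))%:~R.
have xE : x e = \sum_i z i * rhs (r i) + \sum_i (Num.floor (c i))%:~R * rhs (r i).
  rewrite -(dot_chi1 e x) (eq_dot cE (frefl x)) dot_suml -big_split.
  by apply: eq_bigr => i _; rewrite rt /z /=; ring.
rewrite xE rpredD //; last first.
  by apply: rpred_sum => i _; rewrite rpredM ?intr_int ?lhs_int ?rhs_int.
apply: (value_int small fx rx) => [i|f].
  rewrite /z subr_ge0 floor_le lerBlDl ltW //.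
  by have := floorD1_gt (c i); rewrite intrD.
have -> : \sum_i z i * lhs (r i) f
    = chi [set e] f - \sum_i (Num.floor (c i))%:~R * lhs (r i) f.
  by rewrite cE -sumrB; apply: eq_bigr => i _; rewrite /z mulrBl.
rewrite rpredB ?natr_int // rpred_sum // => i _.
by rewrite rpredM ?intr_int ?lhs_int ?rhs_int.
Qed.

(** A fractional cover of cost below k could be moved to a vertex, whose
support is a cover by integrality. *)
Lemma fractional_packing w k : covers_ge w k ->
  exists2 y, fpacking w y & k%:R <= value y.
Proof.
move=> wk; case: (frac_duality w k%:R) => // -[x0 fx0 /(vertex_below fx0)[x [fx xk vx]]].
have xint := vertex_int fx vx.
exfalso; pose B := [set e | 1 <= x e].
have hB : is_cover C B.
  apply/forall_inP => A inCA; apply/set0Pn.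
  have := feasible_member fx inCA; rewrite dotC dot_indic.
  apply: contraPP => h; apply/negP; rewrite -ltNge.
  rewrite big1 ?ltr01 // => e eA; apply/eqP.
  have /natrP[[|m] xm] : x e \is a Num.nat by rewrite natrEint xint (feasible_ge0 fx).
    by rewrite xm.
  case: h; exists e; rewrite !inE eA xm andbT.
  by rewrite ler1n.
have := wk _ hB; rewrite -(ler_nat F) leNgt => /negP; apply.
apply: le_lt_trans xk; rewrite weightE.
apply: ler_sum => e _; apply: ler_wpM2l; first exact: ler0n.
rewrite chiX inE; case: (lerP 1 (x e)) => // _.
exact: feasible_ge0 fx e.
Qed.

End Ideal.

(** * Complementary slackness and independence *)

Implicit Types c : {set E} -> F.

Lemma fpacking_covers_ge w y j : fpacking w y -> j%:R <= value y -> covers_ge w j.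
Proof.
move=> py jy B hB; rewrite -(ler_nat F) weightE.
exact: le_trans jy (weak_duality py (feasible_cover hB)).
Qed.

Lemma comp_slackness w k B y : is_cover C B -> weight w B = k -> fpacking w y ->
  k%:R <= value y ->
  [/\ forall e, e \in B -> load y e = (w e)%:R,
      forall A, A \in C -> y A != 0 -> #|A :&: B| = 1%N & value y = k%:R].
Proof.
move=> hB wB [y0 yw] ky.
have yB : dot (load y) (chi B) = \sum_(A in C) y A * #|A :&: B|%:R.
  by rewrite dot_load; apply: eq_bigr => A _; rewrite dot_chiI.
have d1 : 0 <= \sum_(A in C) (y A * #|A :&: B|%:R - y A).
  apply: sumr_ge0 => A inCA; rewrite subr_ge0 ler_peMr // ler1n.
  exact: cover_card hB inCA.
have d2 : 0 <= \sum_(e in B) ((w e)%:R - load y e).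
  by apply: sumr_ge0 => e _; rewrite subr_ge0; exact: yw.
have dE : \sum_(A in C) (y A * #|A :&: B|%:R - y A)
    + \sum_(e in B) ((w e)%:R - load y e) = k%:R - value y.
  rewrite !sumrB -yB dot_indic -/(value y) -wB /weight natr_sum; ring.
have e1 : \sum_(A in C) (y A * #|A :&: B|%:R - y A) = 0 by lra.
have e2 : \sum_(e in B) ((w e)%:R - load y e) = 0 by lra.
split; last by lra.
- move=> e eB; apply/esym/eqP; rewrite -subr_eq0; apply/eqP.
  apply: (psumr_eq0P _ e2) => // i _; rewrite subr_ge0; exact: yw.
- move=> A inCA yA; apply/eqP.
  have : y A * #|A :&: B|%:R - y A == 0.
    apply/eqP; apply: (psumr_eq0P _ e1) => // A' inCA'.
    by rewrite subr_ge0 ler_peMr // ler1n; exact: cover_card hB inCA'.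
  by rewrite -[X in _ - X]mulr1 -mulrBr mulf_eq0 (negbTE yA) subr_eq0 pnatr_eq1.
Qed.

Definition supp y := [set A in C | y A != 0].

(** Linear independence of the characteristic vectors of the members in X. *)
Definition indep (X : {set {set E}}) := forall c, (forall A, A \notin X -> c A = 0) ->
  (forall e, load c e = 0) -> forall A, c A = 0.

(** The incidence matrices of X and D on S have independent rows, those of D
because each has a private column, and the product of one with the transpose
of the other is the all-ones matrix, of rank 1.  Sylvester's rank inequality
concludes. *)
Lemma card_indep (X D : {set {set E}}) (S : {set E}) :
  X \subset C -> indep X -> (forall A, A \in X -> A \subset S) ->
  (forall A B, A \in X -> B \in D -> #|A :&: B| = 1%N) ->
  (forall B, B \in D -> exists2 e, e \in S :&: B
     & forall B', B' \in D -> e \in B' -> B' = B) ->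
  (#|X| + #|D| <= #|S| + 1)%N.
Proof.
move=> XC iX XS XD priv.
pose M : 'M[F]_(#|X|, #|S|) := \matrix_(i, j) chi (enum_val i) (enum_val j).
pose N : 'M[F]_(#|D|, #|S|) := \matrix_(i, j) chi (enum_val i) (enum_val j).
have freeM : row_free M.
  rewrite -kermx_eq0; apply/rowV0P => v /sub_kermxP vM.
  pose c A := \sum_i v 0 i * (A == enum_val i)%:R.
  have cX A : A \notin X -> c A = 0.
    move=> AX; apply: big1 => i _; rewrite (_ : (A == _) = false) ?mulr0 //.
    by apply: contraNF AX => /eqP ->; exact: enum_valP.
  have ci i : c (enum_val i) = v 0 i.
    rewrite /c (bigD1 i) //= eqxx mulr1 big1 ?addr0 // => j ij.
    by rewrite (inj_eq enum_val_inj) eq_sym (negbTE ij) mulr0.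
  suff c0 A : c A = 0 by apply/rowP => i; rewrite mxE -ci c0.
  apply: iX => // e.
  rewrite /load.
  under eq_bigr => A' _ do rewrite /c mulr_suml.
  rewrite exchange_big /=.
  transitivity (\sum_i v 0 i * chi (enum_val i) e).
    apply: eq_bigr => i _; rewrite (bigD1 (enum_val i)) /=; last first.
      exact: (fintype.subsetP XC) (enum_valP i).
    by rewrite eqxx mulr1 big1 ?addr0 // => A' /andP[_ /negbTE ->]; rewrite mulr0 mul0r.
  have [eS|eS] := boolP (e \in S).
    have := congr1 (fun Z : 'M_(_, _) => Z 0 (enum_rank_in eS e)) vM.
    rewrite !mxE => vMe; rewrite -[RHS]vMe; apply: eq_bigr => i _.
    by rewrite mxE enum_rankK_in.
  apply: big1 => i _; rewrite chiX (_ : (e \in _) = false) ?mulr0 //.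
  by apply: contraNF eS; apply/fintype.subsetP; exact: XS (enum_valP i).
have freeN : row_free N.
  rewrite -kermx_eq0; apply/rowV0P => v /sub_kermxP vN.
  apply/rowP => i; have [e /setIP[eS ei] ep] := priv _ (enum_valP i).
  have := congr1 (fun Z : 'M_(_, _) => Z 0 (enum_rank_in eS e)) vN.
  rewrite !mxE (bigD1 i) //= mxE enum_rankK_in // chiX ei mulr1 big1 ?addr0 // => j ji.
  rewrite mxE enum_rankK_in // chiX (_ : (e \in _) = false) ?mulr0 //.
  apply: contraNF ji => ej; apply/eqP/enum_val_inj.
  exact: ep (enum_valP j) ej.
have MN : M *m N^T = (const_mx 1 : 'M_(_, 1)) *m (const_mx 1 : 'M_(1, _)).
  apply/matrixP => i j; rewrite !mxE big_ord1 !mxE mulr1.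
  have AS := XS _ (enum_valP i).
  have := XD _ _ (enum_valP i) (enum_valP j).
  set A := enum_val i in AS *; set B := enum_val j => AB.
  transitivity (\sum_(e in S) chi A e * chi B e).
    rewrite [RHS](big_enum_val (fun e => chi A e * chi B e)) /=.
    by apply: eq_bigr => l _; rewrite !mxE.
  rewrite -[RHS]/(1%:R) -AB -dot_chiI /dot [LHS]big_mkcond; apply: eq_bigr => e _.
  case: ifPn => // eS; rewrite [chi A e]chiX (_ : (e \in A) = false) ?mul0r //.
  by apply: contraNF eS; apply/fintype.subsetP.
have := mxrank_mul_min M N^T; rewrite mxrank_tr MN.
move: freeM freeN => /eqP -> /eqP ->.
have : (\rank ((const_mx 1%R : 'M[F]_(#|X|, 1))
               *m (const_mx 1%R : 'M_(1, #|D|))) <= 1)%N.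
  by apply: leq_trans (mxrankM_maxl _ _) (rank_leq_col _).
lia.
Qed.

Lemma load_comb y c t e : load (fun A => y A + t * c A) e = load y e + t * load c e.
Proof.
by rewrite /load mulr_sumr -big_split; apply: eq_bigr => A _ /=; ring.
Qed.

Lemma value_comb y c t : value (fun A => y A + t * c A) = value y + t * value c.
Proof. by rewrite /value mulr_sumr -big_split. Qed.

Lemma eq_load y c e : {in C, y =1 c} -> load y e = load c e.
Proof. by move=> yc; apply: eq_bigr => A inCA; rewrite yc. Qed.

Lemma eq_value y c : {in C, y =1 c} -> value y = value c.
Proof. exact: eq_bigr. Qed.

Lemma load_delta A : A \in C -> forall e, load (fun A' => (A' == A)%:R) e = chi A e.
Proof.
move=> inCA e; rewrite /load (bigD1 A) //= eqxx mul1r big1 ?addr0 //.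
by move=> A' /andP[_ /negbTE ->]; rewrite mul0r.
Qed.

Lemma value_delta A : A \in C -> value (fun A' => (A' == A)%:R) = 1.
Proof.
move=> inCA; rewrite /value (bigD1 A) //= eqxx big1 ?addr0 //.
by move=> A' /andP[_ /negbTE ->].
Qed.

Lemma value_eq0_of_load c B : (forall e, load c e = 0) ->
  (forall A, A \in C -> c A != 0 -> #|A :&: B| = 1%N) -> value c = 0.
Proof.
move=> c0 cB; have : dot (load c) (chi B) = 0.
  by apply: big1 => e _; rewrite c0 mul0r.
rewrite dot_load => <-; apply: eq_bigr => A inCA.
have [->|cA] := eqVneq (c A) 0; first by rewrite mul0r.
by rewrite dot_chiI cB // mulr1.
Qed.

(** * Optimal packings of a minimal counterexample *)

Section MinimalCounterexample.
Variables (w : E -> nat) (k : nat).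
Definition mincovers := [set B | is_cover C B && (weight w B == k)].
Notation M := mincovers.

Hypothesis M_covers : forall e, exists2 B, B \in M & e \in B.
Hypothesis smaller : forall j, (j < k)%N -> forall w', covers_ge w' j -> packs w' j.
Hypothesis w_cov : covers_ge w k.
Hypothesis k_gt0 : (0 < k)%N.
Hypothesis E_covers : is_cover C [set: E].
Hypothesis not_packs : ~ packs w k.

Definition optimal y := fpacking w y /\ value y = k%:R.

Lemma optimal_load y : optimal y -> forall e, load y e = (w e)%:R.
Proof.
move=> [py vy] e; have [B] := M_covers e; rewrite inE => /andP[hB /eqP wB] eB.
by have [|h _ _] := comp_slackness hB wB py; [rewrite vy | exact: h].
Qed.

Lemma support_card y A B : optimal y -> A \in supp y -> B \in M -> #|A :&: B| = 1%N.
Proof.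
move=> [py vy]; rewrite !inE => /andP[inCA yA] /andP[hB /eqP wB].
by have [|_ h _] := comp_slackness hB wB py; [rewrite vy | exact: h].
Qed.

Lemma exists_weight : exists e, (0 < w e)%N.
Proof.
apply: contrapT => /forallNP h; have := w_cov E_covers.
rewrite /weight big1 ?leqn0; first by rewrite eqn0Ngt k_gt0.
by move=> e _; apply/eqP; rewrite eqn0Ngt; apply/negP.
Qed.

Lemma exists_mincover : exists B, B \in M.
Proof. by have [e _] := exists_weight; have [B] := M_covers e; exists B. Qed.

(** Otherwise w dominates A; what remains has the fractional packing y minus A
of value k - 1, hence an integer packing of that value, to which A can be
added. *)
Lemma optimal_lt1 y A : optimal y -> A \in C -> y A < 1.
Proof.
move=> oy inCA; have [[y0 _] vy] := oy; rewrite ltNge; apply/negP => yA.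
pose w1 e := (w e - (e \in A))%N.
have w1E e : (w1 e)%:R = (w e)%:R - chi A e.
  rewrite chiX -natrB // -(ler_nat F) -(optimal_load oy).
  rewrite /load (bigD1 A) //= -[leLHS]addr0 lerD //.
    by rewrite chiX; case: (e \in A); rewrite ?mulr1 ?mulr0.
  by apply: sumr_ge0 => A' _; rewrite mulr_ge0 // ler0n.
have w1k : covers_ge w1 k.-1.
  apply: (@fpacking_covers_ge _ (fun A' => y A' + (-1) * (A' == A)%:R)).
    split=> [A'|e].
      by case: eqP => [->|_]; rewrite ?mulr0 ?addr0 // mulr1 subr_ge0.
    by rewrite load_comb load_delta // /wvec w1E (optimal_load oy) mulN1r.
  rewrite value_comb value_delta // vy -{2}(prednK k_gt0) -natr1; lra.
have km1 : (k.-1 < k)%N by rewrite prednK.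
have [z pz kz] := smaller km1 w1k.
have delta (P : pred {set E}) : (\sum_(A' | P A') (A' == A) = P A)%N.
  rewrite big_mkcond (bigD1 A) //= eqxx big1 => [|A' /negbTE ->]; last by case: ifP.
  by rewrite addn0; case: (P A).
have wA e : e \in A -> (0 < w e)%N.
  move=> eA; rewrite -(ltr_nat F) -(optimal_load oy).
  apply: (@lt_le_trans _ _ (y A)); first exact: lt_le_trans yA.
  rewrite /load (bigD1 A) //= chiX eA mulr1 lerDl.
  by apply: sumr_ge0 => A' _; rewrite mulr_ge0 // ler0n.
apply: not_packs; exists (fun A' => (z A' + (A' == A))%N).
  move=> e; rewrite big_split /= delta inCA /=.
  by have := pz e; rewrite /w1; case: (boolP (e \in A)) => [/wA|_] /=; lia.
by rewrite big_split /= delta inCA addn1 -(prednK k_gt0) ltnS.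
Qed.

(** Ratio test: move from y in direction c until a coefficient vanishes.  The
direction changes neither the load nor the value. *)
Lemma exchange y c : optimal y -> (forall e, load c e = 0) -> value c = 0 ->
  (forall A, A \in C -> A \notin supp y -> 0 <= c A) ->
  (exists2 A, A \in C & c A < 0) ->
  exists y', optimal y' /\ exists t,
    {in C, y' =1 fun A => y A + t * c A}
    /\ exists2 A, A \in supp y & A \notin supp y'.
Proof.
move=> [[y0 yw] vy] lc vc cpos [A0 A0C cA0].
have sup A : A \in C -> c A < 0 -> A \in supp y.
  by move=> inCA cA; apply: contraLR cA => /(cpos _ inCA); rewrite -leNgt.
pose V := [pred A | (A \in C) && (c A < 0)].
have V0 : V A0 by rewrite /V /= A0C.
case: (arg_minP (fun A => y A / - c A) V0) => A1 /andP[A1C cA1] A1min.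
set t := y A1 / - c A1 in A1min.
have yA1 : 0 < y A1.
  by have := sup _ A1C cA1; rewrite inE => /andP[_]; rewrite lt0r y0 andbT.
have t0 : 0 < t by rewrite divr_gt0 ?oppr_gt0.
pose y' A := if A \in C then y A + t * c A else y A.
have y'E : {in C, y' =1 fun A => y A + t * c A} by move=> A inCA; rewrite /y' inCA.
exists y'; split; first split; first split.
- move=> A; rewrite /y'; case: ifP => // inCA.
  have [cA|cA] := lerP 0 (c A); first by rewrite addr_ge0 // mulr_ge0 // ltW.
  have : t <= y A / - c A by apply: A1min; rewrite /V /= inCA.
  rewrite ler_pdivlMr ?oppr_gt0 //; lra.
- by move=> e; rewrite (eq_load e y'E) load_comb lc mulr0 addr0.
- by rewrite (eq_value y'E) value_comb vc mulr0 addr0.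
exists t; split=> //; exists A1; first exact: sup.
rewrite inE A1C /= y'E //= negbK /t; apply/eqP; field.
by rewrite lt_eqF.
Qed.

(** Asking for the smallest support among all optimal packings, rather than for
an independent one, spares the proof that a pivot preserves independence. *)
Definition basic y := optimal y /\ forall y', optimal y' -> (#|supp y| <= #|supp y'|)%N.

Lemma basic_indep y : basic y -> indep (supp y).
Proof.
move=> [oy miny].
have [B BM] := exists_mincover.
have key c : (forall A, A \notin supp y -> c A = 0) -> (forall e, load c e = 0) ->
   forall A, 0 <= c A.
  move=> cs lc A; rewrite leNgt; apply/negP => cA.
  have As : A \in supp y by apply: contraLR cA => /cs ->; rewrite ltxx.
  have inCA : A \in C by move: As; rewrite inE => /andP[].
  have vc : value c = 0.
    apply: (value_eq0_of_load (B := B) lc) => A' _ cA'; apply: support_card oy _ BM.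
    by apply: contraNT cA' => /cs ->.
  have [||y' [oy' [t [y'E [A1 A1s A1s']]]]] := exchange oy lc vc.
  - by move=> A' _ /cs ->.
  - by exists A.
  have := miny _ oy'; rewrite leqNgt => /negP; apply.
  apply: proper_card; apply/properP; split; last by exists A1.
  apply/fintype.subsetP => A'; rewrite !inE => /andP[A'C]; rewrite A'C /= y'E //=.
  apply: contraNneq => yA'; rewrite yA' add0r cs ?mulr0 //.
  by rewrite inE A'C yA' eqxx.
move=> c cs lc A; apply/eqP; rewrite eq_le (key c) // andbT.
rewrite -oppr_ge0; apply: (key (fun A => - c A)) => [A' /cs ->|e]; first by rewrite oppr0.
rewrite -[RHS]oppr0 -(lc e) /load -sumrN.
by apply: eq_bigr => A' _; rewrite mulNr.
Qed.

Lemma exists_basic : (exists y, optimal y) -> exists y, basic y.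
Proof.
move=> [y0 oy0]; pose P m := `[< exists2 y, optimal y & #|supp y| = m >].
have exP : exists m, P m by exists #|supp y0|; apply/asboolP; exists y0.
case: (ex_minnP exP) => m /asboolP[y oy ym] mmin; exists y; split=> // y' oy'.
by rewrite ym; apply: mmin; apply/asboolP; exists y'.
Qed.

Lemma supp_sub y : supp y \subset C.
Proof. by apply/fintype.subsetP => A; rewrite inE => /andP[]. Qed.

(** A0 depends on the support of y with coefficient 1 on A0 itself, and the
coefficients of a dependency sum to 0, so some coefficient is negative and the
ratio test applies.  Minimality of the support leaves no room for more than one
member to leave. *)
Lemma basic_swap y A0 : basic y -> A0 \in C -> A0 \notin supp y ->
  (forall B, B \in M -> #|A0 :&: B| = 1%N) -> ~ indep (A0 |: supp y) ->
  exists2 A1, A1 \in supp y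
    & exists2 y', basic y' & supp y' = A0 |: supp y :\ A1.
Proof.
move=> By A0C A0s A0M nX; have [oy miny] := By.
have [c [cX lc cA0]] : exists c : {set E} -> F,
    [/\ forall A, A \notin A0 |: supp y -> c A = 0,
     forall e, load c e = 0 & c A0 = 1].
  move: nX => /existsNP[c /not_implyP[cX /not_implyP[lc /existsNP[A1 cA1]]]].
  have cA0 : c A0 != 0.
    apply/eqP => cA0; apply: cA1; apply: (basic_indep By) => // A As.
    have [->//|AA0] := eqVneq A A0.
    by apply: cX; rewrite !inE negb_or AA0; move: As; rewrite inE.
  exists (fun A => c A / c A0); split=> [A /cX ->|e|]; rewrite ?mul0r ?divff //.
  rewrite -(mul0r (c A0)^-1) -(lc e) /load mulr_suml.
  by apply: eq_bigr => A _; rewrite mulrAC.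
have [B BM] := exists_mincover.
have vc : value c = 0.
  apply: (value_eq0_of_load (B := B) lc) => A _ cA.
  have : A \in A0 |: supp y by apply: contraNT cA => /cX ->.
  by move=> /setU1P[->|As]; [exact: A0M | exact: support_card oy As BM].
have [||y' [oy' [t [y'E [A1 A1s A1s']]]]] := exchange oy lc vc.
- move=> A inCA As; have [->|AA0] := eqVneq A A0; first by rewrite cA0 ler01.
  by rewrite cX // in_setU1 negb_or AA0.
- apply: contrapT => nneg.
  have cpos A : A \in C -> 0 <= c A.
    by move=> inCA; rewrite leNgt; apply/negP => cA; apply: nneg; exists A.
  by have := psumr_eq0P cpos vc A0C; rewrite cA0 => /eqP; rewrite oner_eq0.
have sub' : supp y' \subset A0 |: supp y :\ A1.
  apply/fintype.subsetP => A As'.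
  have AA1 : A != A1 by apply: contraNneq A1s' => <-.
  rewrite !in_setU1 in_setD1 AA1 /=.
  have inCA := fintype.subsetP (supp_sub y') _ As'.
  apply: contraTT As'; rewrite negb_or => /andP[AA0 As].
  rewrite inE inCA /= y'E //= (cX A) ?in_setU1 ?negb_or ?AA0 // mulr0 addr0.
  by move: As; rewrite inE inCA.
have A0A1 : A0 \notin supp y :\ A1 by rewrite in_setD1 (negbTE A0s) andbF.
have card' : #|A0 |: supp y :\ A1| = #|supp y|.
  by rewrite cardsU1 A0A1 (cardsD1 A1 (supp y)) A1s.
have supp' : supp y' = A0 |: supp y :\ A1.
  by apply/eqP; rewrite eqEcard sub' card' miny.
exists A1 => //; exists y' => //.
by split=> // z oz; rewrite supp' card' miny.
Qed.

(** * The residual weight *)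

(** How often the support of y covers e beyond its weight; the truncated
subtraction is exact for optimal y by [residualE]. *)
Definition residual y e := (\sum_(A in supp y) (e \in A) - w e)%N.
Definition resid_frac y A : F := if A \in supp y then 1 - y A else 0.

Lemma resid_fracE y : {in C, resid_frac y =1 fun A => (A \in supp y)%:R + (-1) * y A}.
Proof.
move=> A inCA; rewrite /resid_frac inE inCA /=.
by case: eqVneq => [->|_]; rewrite ?mulr0 ?addr0 // mulN1r.
Qed.

Lemma resid_frac_gt0 y A : optimal y -> A \in supp y -> 0 < resid_frac y A.
Proof.
move=> oy As; rewrite /resid_frac As subr_gt0 (optimal_lt1 oy) //.
by move: As; rewrite inE => /andP[].
Qed.

Lemma resid_frac_ge0 y A : optimal y -> 0 <= resid_frac y A.
Proof.
move=> oy; have [As|As] := boolP (A \in supp y); first exact/ltW/resid_frac_gt0.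
by rewrite /resid_frac (negbTE As).
Qed.

Lemma residualE y e : optimal y -> load (resid_frac y) e = (residual y e)%:R.
Proof.
move=> oy.
have ind : load (fun A => (A \in supp y)%:R) e = (\sum_(A in supp y) (e \in A))%:R.
  rewrite natr_sum /load (big_setID (supp y)) /= [X in _ + X]big1 => [|A]; last first.
    by rewrite inE => /andP[/negbTE -> _]; rewrite mul0r.
  rewrite addr0 (finset.setIidPr _); first by apply: eq_bigr => A ->; rewrite mul1r.
  by apply/fintype.subsetP => A; rewrite inE => /andP[].
have E1 : load (resid_frac y) e = (\sum_(A in supp y) (e \in A))%:R - (w e)%:R.
  by rewrite (eq_load e (@resid_fracE y)) load_comb (optimal_load oy) ind mulN1r.
rewrite E1 /residual natrB // -(ler_nat F) -subr_ge0 -E1.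
by apply: sumr_ge0 => A _; rewrite mulr_ge0 ?resid_frac_ge0 // ler0n.
Qed.

Lemma value_resid y : optimal y -> value (resid_frac y) = #|supp y|%:R - k%:R.
Proof.
move=> oy; rewrite (eq_value (@resid_fracE y)) value_comb (proj2 oy) mulN1r; congr (_ - _).
rewrite /value -sum1_card natr_sum (big_setID (supp y)) /= [X in _ + X]big1 => [|A]; last first.
  by rewrite inE => /andP[/negbTE ->].
rewrite addr0 (finset.setIidPr _); first by apply: eq_bigr => A ->.
by apply/fintype.subsetP => A; rewrite inE => /andP[].
Qed.

Lemma supp_ge y : optimal y -> (k <= #|supp y|)%N.
Proof.
move=> oy; rewrite -(ler_nat F) -subr_ge0 -value_resid //.
by apply: sumr_ge0 => A _; exact: resid_frac_ge0.
Qed.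

Lemma residual_fpacking y : optimal y -> fpacking (residual y) (resid_frac y).
Proof.
move=> oy; split=> [A|e]; first exact: resid_frac_ge0.
by rewrite residualE.
Qed.

(** The minimum covers of w stay tight for the residual, so complementary
slackness applies to the packings of the residual as well. *)
Lemma weight_residual y B : optimal y -> B \in M ->
  weight (residual y) B = (#|supp y| - k)%N.
Proof.
move=> oy BM; apply/eqP; rewrite -(eqr_nat F) natrB ?supp_ge // weightE.
rewrite -value_resid // (eq_dot (u' := load (resid_frac y)) (v' := chi B)) //.
  rewrite dot_load; apply/eqP; apply: eq_bigr => A _.
  rewrite /resid_frac; case: ifP => As; last by rewrite mul0r.
  by rewrite dot_chiI (support_card oy As BM) mulr1.
by move=> e; rewrite residualE.
Qed.

Lemma residual_packing y : optimal y -> (#|supp y| - k < k)%N ->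
  exists x : {set E} -> nat, [/\ forall e, load (fun A => (x A)%:R) e = (residual y e)%:R,
    value (fun A => (x A)%:R) = (#|supp y| - k)%:R
    & forall A, A \in C -> x A != 0%N -> forall B, B \in M -> #|A :&: B| = 1%N].
Proof.
move=> oy /smaller/(_ (residual y)) [].
  apply: (fpacking_covers_ge (residual_fpacking oy)).
  by rewrite value_resid // natrB // supp_ge.
move=> x /fpacking_nat px; rewrite -(ler_nat F) -value_nat => vx.
have cs B : B \in M -> [/\ forall e, e \in B -> load (fun A => (x A)%:R) e = (residual y e)%:R,
      forall A, A \in C -> (x A)%:R != 0 :> F -> #|A :&: B| = 1%N
      & value (fun A => (x A)%:R) = (#|supp y| - k)%:R].
  move=> BM; have := BM; rewrite inE => /andP[hB _].
  exact: comp_slackness hB (weight_residual oy BM) px vx.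
exists x; split.
- by move=> e; have [B BM eB] := M_covers e; have [h _ _] := cs _ BM; exact: h.
- by have [B BM] := exists_mincover; have [_ _ h] := cs _ BM.
- move=> A inCA xA B BM; have [_ h _] := cs _ BM; apply: h => //.
  by rewrite pnatr_eq0.
Qed.

Definition wsupp := [set e | (0 < w e)%N].

Lemma residual_gt0 y e : optimal y -> e \in wsupp -> (0 < residual y e)%N.
Proof.
move=> oy; rewrite inE => we.
have : load y e != 0 by rewrite optimal_load // pnatr_eq0 -lt0n.
have [[A As eA]|h] := pselect (exists2 A, A \in supp y & e \in A); last first.
  rewrite /load big1 ?eqxx // => A inCA; rewrite chiX.
  have [yA|yA] := eqVneq (y A) 0; first by rewrite yA mul0r.
  case: (boolP (e \in A)) => eA; rewrite ?mulr0 //; case: h; exists A => //.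
  by rewrite inE inCA.
have inCA : A \in C by move: As; rewrite inE => /andP[].
move=> _; rewrite -(ltr_nat F) -residualE // /load (bigD1 A) //= chiX eA mulr1.
rewrite ltr_wpDr ?resid_frac_gt0 //.
by apply: sumr_ge0 => A' _; rewrite mulr_ge0 ?resid_frac_ge0 // ler0n.
Qed.

Lemma optimal_wsupp y A : optimal y -> A \in supp y -> A \subset wsupp.
Proof.
move=> oy As; apply/fintype.subsetP => e eA; rewrite inE.
move: As; rewrite inE => /andP[inCA yA]; have [[y0 _] _] := oy.
rewrite -(ltr_nat F) -(optimal_load oy) /load (bigD1 A) //= chiX eA mulr1.
rewrite ltr_wpDr //; last by rewrite lt0r yA y0.
by apply: sumr_ge0 => A' _; rewrite mulr_ge0 // ler0n.
Qed.

Lemma residual_wsupp y e : optimal y -> e \notin wsupp -> residual y e = 0%N.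
Proof.
move=> oy eS; rewrite /residual big1 ?sub0n // => A As.
by rewrite (contraNF (fintype.subsetP (optimal_wsupp oy As) e) eS).
Qed.

(** In a family of smallest size covering [wsupp], dropping a cover exposes some
element. *)
Lemma private_family : exists D : {set {set E}}, [/\ D \subset M,
  forall e, e \in wsupp -> exists2 B, B \in D & e \in B
  & forall B, B \in D -> exists2 e, e \in wsupp :&: B
       & forall B', B' \in D -> e \in B' -> B' = B].
Proof.
pose P (D : {set {set E}}) := (D \subset M) && [forall e in wsupp, [exists B in D, e \in B]].
have PM : P M.
  rewrite /P subxx /=; apply/forall_inP => e _; apply/exists_inP.
  by have [B BM eB] := M_covers e; exists B.
case: (arg_minnP (fun D : {set {set E}} => #|D|) PM) => D /andP[DM /forall_inP Dw] Dmin.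
exists D; split=> // [e /Dw /exists_inP|B BD]; first by case=> B; exists B.
have : ~~ P (D :\ B).
  by apply/negP => /Dmin; rewrite (cardsD1 B D) BD add1n ltnn.
rewrite /P (fintype.subset_trans (finset.subsetDl _ _) DM) /= => /forall_inPn[e ew].
move=> /exists_inPn eB.
have [B0 B0D eB0] := exists_inP (Dw _ ew).
have uniq B' : B' \in D -> e \in B' -> B' = B.
  move=> B'D eB'; apply/eqP; apply: contraT => BB'.
  by have := eB B'; rewrite !inE BB' B'D eB' => /(_ isT).
by exists e => //; rewrite inE ew -(uniq _ B0D eB0).
Qed.

(** Members of a packing of the residual meet [wsupp] in at most #|D| elements,
as D covers [wsupp] and each cover in D meets a member once. *)
Lemma residual_total y (D : {set {set E}}) : optimal y ->
  (#|supp y| - k < k)%N -> D \subset M ->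
  (forall e, e \in wsupp -> exists2 B, B \in D & e \in B) ->
  (\sum_(e in wsupp) residual y e <= (#|supp y| - k) * #|D|)%N.
Proof.
move=> oy sk DM Dcov; have [x [xl xv xc]] := residual_packing oy sk.
have size_member A : A \in C -> x A != 0%N -> (#|A :&: wsupp| <= #|D|)%N.
  move=> inCA xA; rewrite -sum1_card.
  apply: (@leq_trans (\sum_(B in D) #|A :&: B|)%N); last first.
    rewrite -sum1_card; apply: leq_sum => B BD.
    by rewrite (xc _ inCA xA) // (fintype.subsetP DM).
  rewrite [leqRHS](eq_bigr (fun B => \sum_e (e \in A :&: B)))%N; last first.
    by move=> B _; rewrite -sum1_card big_mkcond.
  rewrite exchange_big /= [leqLHS]big_mkcond; apply: leq_sum => e _.
  case: ifP => // /setIP[eA /Dcov[B BD eB]].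
  by rewrite (bigD1 B) //= inE eA eB.
rewrite -(ler_nat F) natr_sum natrM -xv.
rewrite -(eq_bigr _ (fun e _ => xl e)) -dot_indic dot_load /value mulr_suml.
apply: ler_sum => A inCA; have [->|xA] := eqVneq (x A) 0%N; first by rewrite !mul0r.
by rewrite dot_chiI ler_wpM2l ?ler0n // ler_nat size_member.
Qed.

(** Inside the independent support of y the residual has only one expansion,
whose coefficients 1 - y A lie strictly between 0 and 1. *)
Lemma residual_packing_new_member y (x : {set E} -> nat) : basic y ->
  (forall e, load (fun A => (x A)%:R) e = (residual y e)%:R) ->
  exists2 A, A \in C & x A != 0%N /\ A \notin supp y.
Proof.
move=> By xl; have [oy _] := By; apply: contrapT => sub.
have [A As] : exists A, A \in supp y.
  by apply/card_gt0P; exact: leq_trans k_gt0 (supp_ge oy).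
pose c A' : F := if A' \in C then (x A')%:R + (-1) * resid_frac y A' else 0.
have cE : {in C, c =1 fun A' => (x A')%:R + (-1) * resid_frac y A'}.
  by move=> A' inCA'; rewrite /c inCA'.
have cs A' : A' \notin supp y -> c A' = 0.
  rewrite /c; case: ifP => // inCA' A's.
  rewrite /resid_frac (negbTE A's) mulr0 addr0; apply/eqP; rewrite pnatr_eq0.
  by apply: contrapT => /negP xA'; apply: sub; exists A'.
have lc e : load c e = 0.
  by rewrite (eq_load e cE) load_comb xl residualE // mulN1r subrr.
have := basic_indep By cs lc A; rewrite cE ?(fintype.subsetP (supp_sub y)) //= => /eqP.
rewrite mulN1r subr_eq0 => /eqP xA.
have := resid_frac_gt0 oy As; rewrite -xA ltr0n.
have : (x A)%:R < 1%:R :> F.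
  rewrite xA /resid_frac As ltrBlDr ltrDl.
  by move: As; rewrite inE lt0r => /andP[_ ->]; have [[y0 _] _] := oy; rewrite y0.
by rewrite ltr_nat; lia.
Qed.

Theorem optimal_small_value : (exists y, optimal y) -> small_value #|E| k.
Proof.
move=> /exists_basic[y By]; have [oy miny] := By.
have [D [DM Dcov priv]] := private_family.
have [e0 we0] := exists_weight.
have e0S : e0 \in wsupp by rewrite inE.
have S0 : (0 < #|wsupp|)%N by apply/card_gt0P; exists e0.
have Sn : (#|wsupp| <= #|E|)%N by exact: max_card.
have inM B : B \in D -> B \in M by exact: (fintype.subsetP DM).
have D0 : (0 < #|D|)%N.
  by apply/card_gt0P; have [B BD _] := Dcov _ e0S; exists B.
have rank (X : {set {set E}}) : X \subset C -> indep X ->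
    (forall A, A \in X -> A \subset wsupp) ->
    (forall A B, A \in X -> B \in M -> #|A :&: B| = 1%N) ->
    (#|X| + #|D| <= #|wsupp| + 1)%N.
  by move=> XC iX XS XM; apply: card_indep => // A B AX /inM; exact: XM.
have ys A : A \in supp y -> A \subset wsupp by exact: optimal_wsupp.
have yM A B : A \in supp y -> B \in M -> #|A :&: B| = 1%N by exact: support_card.
have dim := rank _ (supp_sub y) (basic_indep By) ys yM.
set m := #|supp y| in dim.
have [km|mk] := leqP k (m - k).
  by left; lia.
have km : (k <= m)%N by exact: supp_ge.
have card_basic y' : basic y' -> #|supp y'| = m.
  by move=> [oy' miny']; apply/eqP; rewrite eqn_leq miny // miny'.
have total y' : basic y' -> (\sum_(e in wsupp) residual y' e <= (m - k) * #|D|)%N.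
  move=> By'; rewrite -(card_basic _ By').
  by apply: residual_total; rewrite ?(card_basic _ By') //; case: By'.
have count : (#|wsupp| <= \sum_(e in wsupp) residual y e)%N.
  by rewrite -sum1_card; apply: leq_sum => e; exact: residual_gt0.
have nle := leq_trans count (total _ By).
have lin : (k + (m - k) + #|D| <= #|wsupp| + 1)%N by lia.
(* What remains is the extremal case, in which no inequality has any slack. *)
apply: contrapT => big.
have no alt := big (small_value_of_counts S0 Sn k_gt0 lin nle alt).
have mdim : (m + #|D| = #|wsupp| + 1)%N.
  by apply/eqP; rewrite eqn_leq dim leqNgt; apply/negP => h; apply: no; apply: Or31; lia.
have nsd : #|wsupp| = ((m - k) * #|D|)%N.
  by apply/eqP; rewrite eqn_leq nle leqNgt; apply/negP => h; apply: no; apply: Or32.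
have one y' e : basic y' -> e \in wsupp -> residual y' e = 1%N.
  move=> By' eS; have [oy' _] := By'.
  have : (\sum_(f in wsupp) (residual y' f - 1) == 0)%N.
    rewrite sumnB; last by move=> f; exact: residual_gt0.
    by rewrite sum1_card subn_eq0 nsd total.
  rewrite sum_nat_eq0 => /forall_inP/(_ _ eS); have := residual_gt0 oy' eS; lia.
have degree y' e : basic y' ->
    (\sum_(A in supp y') (e \in A))%N = (w e + (e \in wsupp))%N.
  move=> By'; have [oy' _] := By'; have [eS|eS] := boolP (e \in wsupp).
    by have := one y' e By' eS; rewrite /residual; lia.
  rewrite big1 => [|A As]; first by move: eS; rewrite inE; lia.
  by rewrite (contraNF (fintype.subsetP (optimal_wsupp oy' As) e) eS).
have [x [xl _ xc]] := residual_packing oy mk.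
have [A0 A0C [xA0 A0s]] := residual_packing_new_member By xl.
have A0S : A0 \subset wsupp.
  apply/fintype.subsetP => e eA0; apply: contraT => eS.
  have := xl e; rewrite residual_wsupp //.
  have : 0 < load (fun A => (x A)%:R) e.
    rewrite /load (bigD1 A0) //= chiX eA0 mulr1 ltr_wpDr ?ltr0n ?lt0n //.
    by apply: sumr_ge0 => A' _; rewrite mulr_ge0 // ler0n.
  by move=> + l0; rewrite l0 ltxx.
have nX : ~ indep (A0 |: supp y).
  move=> iX; suff : (#|A0 |: supp y| + #|D| <= #|wsupp| + 1)%N.
    by rewrite cardsU1 A0s -/m; lia.
  apply: rank => //.
  - by apply/fintype.subsetP => A /setU1P[->//|]; exact: (fintype.subsetP (supp_sub y)).
  - by move=> A /setU1P[->//|]; exact: ys.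
  - by move=> A B /setU1P[->|As] BM; [exact: xc | exact: yM].
have [A1 A1s [y' By' supp']] := basic_swap By A0C A0s (xc _ A0C xA0) nX.
have A0A1 : A0 \notin supp y :\ A1 by rewrite in_setD1 (negbTE A0s) andbF.
have A01 : A0 = A1.
  apply/finset.setP => e; have := degree y' e By'; rewrite -(degree y e By) supp'.
  rewrite (big_setU1 _ A0A1) (big_setD1 _ A1s) /=.
  by move/eqP; rewrite eqn_add2r => /eqP; do 2 case: (e \in _).
by move: A0s; rewrite A01 A1s.
Qed.

End MinimalCounterexample.

End Clutter.

(** * Back to tau and nu *)

Section Bridge.
Variables (E : finType) (C : {set {set E}}).
Hypothesis C0 : finset.set0 \notin C.
Implicit Types (A B : {set E}) (w : E -> nat).
Notation covers_ge := (covers_ge C).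
Notation packs := (packs C).

Lemma setT_cover : is_cover C [set: E].
Proof. by apply/forall_inP => A inCA; rewrite finset.setTI; apply: contraNneq C0 => <-. Qed.

Lemma packing_le_weight w (y : {set E} -> nat) B : packing C w y -> is_cover C B ->
  (\sum_(A in C) y A <= weight w B)%N.
Proof.
move=> /(fpacking_nat rat) py hB.
by rewrite -(ler_nat rat) -value_nat (weightE rat) (weak_duality py) //; exact: feasible_cover.
Qed.

Lemma tau_eq_nuP w : tau C w = nu C w <-> forall k, covers_ge w k -> packs w k.
Proof.
have [[B [hB wB]] tau_le] := tau_attained w C0; split=> [tn k wk|h].
  have [y py ny] := nu_attained w C0; exists y => //.
  by move: wB; rewrite tn ny => -[/= <-]; exact: wk.
have [|y py ky] := h (weight w B).
  by move=> B' /tau_le; rewrite -wB lee_fin lez_nat.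
rewrite -wB /nu; apply/esym/supremum_max.
  exists y => //; congr (EFin (Posz _)).
  by apply/eqP; rewrite eqn_leq ky packing_le_weight.
by move=> _ [z pz <-]; rewrite lee_fin lez_nat packing_le_weight.
Qed.

Lemma tau_eq w k B : covers_ge w k -> B \in mincovers C w k -> tau C w = k%:Z%:E.
Proof.
rewrite inE => wk /andP[hB /eqP wB].
have [[B' [hB' wB']] tau_le] := tau_attained w C0.
apply/eqP; rewrite eq_le -{1}wB tau_le //= -wB' lee_fin lez_nat; exact: wk.
Qed.

(** When no weight can be lowered without pushing some cover below k, each
element of positive weight lies in a cover of weight k; elements of weight 0
can be added to such a cover for free. *)
Lemma tight_reduction w k : covers_ge w k -> exists w',
  [/\ forall e, (w' e <= w e)%N, covers_ge w' k,
      exists B, B \in mincovers C w' k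
    & forall e, exists2 B, B \in mincovers C w' k & e \in B].
Proof.
move: {2}(\sum_e w e).+1%N (ltnSn (\sum_e w e)) => m.
elim: m w => // m IH w; rewrite ltnS => wm wk.
have [[f [wf wfk]]|tightw] := pselect (exists f, (0 < w f)%N /\
    covers_ge (fun e => (w e - (e == f))%N) k).
  have [|//|w' [w'w h1 h2 h3]] := IH (fun e => (w e - (e == f))%N).
    apply: leq_trans wm; rewrite [ltnRHS](bigD1 f) //= (bigD1 f) //= eqxx.
    rewrite -addSn leq_add //; first by lia.
    by apply: leq_sum => e _; rewrite leq_subr.
  by exists w'; split=> // e; apply: leq_trans (w'w e) (leq_subr _ _).
have pos e : (0 < w e)%N -> exists2 B, B \in mincovers C w k & e \in B.
  move=> we; apply: contrapT => h; apply: tightw; exists e; split=> // B hB.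
  have kB := wk _ hB.
  have [eB|eB] := boolP (e \in B); last first.
    apply: leq_trans kB _; apply: leq_sum => e' e'B.
    by rewrite (_ : (e' == e) = false) ?subn0 //; apply: contraNF eB => /eqP <-.
  have : (k < weight w B)%N.
    rewrite ltn_neqAle kB andbT; apply/eqP => kwB; apply: h; exists B => //.
    by rewrite inE hB -kwB eqxx.
  rewrite /weight (bigD1 e) //= => hk; rewrite (bigD1 e) //= eqxx.
  rewrite (eq_bigr w) => [|e' /andP[_ /negbTE ->]]; last by rewrite subn0.
  by lia.
have [B BM] : exists B, B \in mincovers C w k.
  have [[e /pos[B BM _]]|h] := pselect (exists e, (0 < w e)%N); first by exists B.
  exists finset.setT; rewrite inE setT_cover /=; have := wk _ setT_cover.
  rewrite /weight big1 ?leqn0 ?[_ == k]eq_sym // => e _; apply/eqP; rewrite eqn0Ngt.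
  by apply/negP => we; apply: h; exists e.
exists w; split=> // [|e]; first by exists B.
have [/pos//|we] := ltnP 0 (w e).
exists (e |: B); rewrite ?setU11 //.
move: BM; rewrite !inE => /andP[/forall_inP hB /eqP wB]; apply/andP; split.
  apply/forall_inP => A inCA; have /set0Pn[f] := hB _ inCA.
  rewrite inE => /andP[fB fA]; apply/set0Pn; exists f.
  by rewrite !inE fB orbT fA.
have [eB|eB] := boolP (e \in B).
  by rewrite (finset.setUidPr _) ?finset.sub1set // wB.
by rewrite /weight (big_setU1 _ eB) /= -/(weight w B) wB; lia.
Qed.

Lemma packs_mono w w' k : (forall e, (w' e <= w e)%N) -> packs w' k -> packs w k.
Proof. by move=> ww [y py ky]; exists y => // e; exact: leq_trans (py e) (ww e). Qed.

(** Strong induction on k: a failure at a value k that is not small would be a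
minimal counterexample, whose value is small by [optimal_small_value]. *)
Lemma packs_of_small (F : archiRealFieldType) :
  (forall j, small_value #|E| j -> forall w, covers_ge w j -> packs w j) ->
  forall k w, covers_ge w k -> packs w k.
Proof.
move=> small; elim/ltn_ind => k smaller w wk.
have [/small|nsmall] := pselect (small_value #|E| k); first exact.
have [w' [ww w'k [B0 _] cov]] := tight_reduction wk.
apply: (packs_mono ww); apply: contrapT => np; apply: nsmall.
have [->|k0] := posnP k; first by left; rewrite muln0.
apply: (@optimal_small_value F E C w' k) => //.
  exact: setT_cover.
have [|y py ky] := @fractional_packing F E C _ w' k w'k; first by move=> j j2; apply: small; left.
exists y; split=> //.
have [e _] := @exists_weight E C w' k w'k k0 setT_cover.
have [B] := cov e; rewrite inE => /andP[hB /eqP wB] _.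
by have [] := comp_slackness hB wB py ky.
Qed.
End Bridge.

Theorem theorem1 (R : realType) (n : nat) (E : finType) (C : {set {set E}})
    (hE : #|E| = n) (hC : clutter C) :
  mfmc C <->
  (forall w : E -> nat,
     (forall e : E, exists2 B : {set E}, min_cover C w B & e \in B) ->
     (tau C w <=
        (Order.max
           (Num.ceil (n%:R / 2 : R))
           (Num.floor (n%:R - Num.sqrt (4 * n%:R + 1) + 1 : R)))%:E)%E ->
     tau C w = nu C w).
Proof.
split=> [mf w _ _|h]; first exact: mf.
have [C0|C0] := boolP (finset.set0 \in C); last first.
  move=> w; apply/(tau_eq_nuP C0) => k; apply: (packs_of_small C0 R) => // j sj {}w wj.
  have [w' [ww w'j [B BM] cov]] := tight_reduction C0 wj.
  apply: (packs_mono ww).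
  have tj := tau_eq C0 w'j BM.
  apply: (tau_eq_nuP C0 w').1 w'j; apply: h => [e|].
    have [B' B'M eB'] := cov e; exists B' => //.
    by move: B'M; rewrite inE => /andP[hB' /eqP wB']; split=> //; rewrite wB' tj.
  by rewrite tj lee_fin; apply: small_value_le; rewrite -hE.
have -> : C = [set finset.set0]%SET.
  apply/finset.setP => A; rewrite inE; apply/idP/eqP => [inCA|->//].
  by apply/esym/hC => //; exact: finset.sub0set.
by move=> w; rewrite tau_trivial nu_trivial.
Qed.
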